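(* Let $\mathcal{C}$ be a collection of $n \geq 2$ pairwise disjoint compact convex sets in the plane. Then there is a pair of distinct sets $A, B \in \mathcal{C}$ such that every line that separates $A$ from $B$ separates either $A$ or $B$ from a subcollection $\mathcal{F} \subseteq \mathcal{C}$ consisting of at least $\frac{n}{18}$ sets.
   Context: A line $l$ separates a set $X$ from a set $Y$ if $X$ and $Y$ lie in opposite closed half-planes determined by $l$. A line $l$ separates a set $X$ from a collection $\mathcal{F}$ of sets if $X$ lies in one closed half-plane determined by $l$ and every member of $\mathcal{F}$ lies in the opposite closed half-plane. *)

(* Defs.v *)
From mathcomp Require Import all_boot all_order all_algebra.
From mathcomp Require Import all_classical all_reals all_analysis.

Set Implicit Arguments.
Unset Strict Implicit.
Unset Printing Implicit Defensive.

Import Order.TTheory GRing.Theory Num.Theory.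

Local Open Scope classical_set_scope.
Local Open Scope ring_scope.

(* The line of equation <normal, x> = offset in the plane 'rV[R]_2.
   Proportional coefficients describe the same line, and the same unordered
   pair of closed half-planes. *)
Record line (R : realType) := Line {
  normal : 'rV[R]_2;
  offset : R;
  normal_neq0 : normal != 0 }.

Definition linear_form (R : realType) (l : line R) (x : 'rV[R]_2) : R :=
  \sum_(i < 2) normal l 0 i * x 0 i.

Definition lower_half_plane (R : realType) (l : line R) : set 'rV[R]_2 :=
  [set x | linear_form l x <= offset l].

Definition upper_half_plane (R : realType) (l : line R) : set 'rV[R]_2 :=
  [set x | offset l <= linear_form l x].

Definition separates (R : realType) (l : line R) (X Y : set 'rV[R]_2) : Prop :=
  (X `<=` lower_half_plane l /\ Y `<=` upper_half_plane l) \/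
  (X `<=` upper_half_plane l /\ Y `<=` lower_half_plane l).

(* All members of F lie on the same side, opposite to X; this is stronger than
   separating X from each member of F when X is contained in l. *)
Definition separates_collection (R : realType) (l : line R)
    (X : set 'rV[R]_2) (F : set (set 'rV[R]_2)) : Prop :=
  (X `<=` lower_half_plane l /\
     (forall Y, F Y -> Y `<=` upper_half_plane l)) \/
  (X `<=` upper_half_plane l /\
     (forall Y, F Y -> Y `<=` lower_half_plane l)).

(* Main.v *)
Require Import Defs.
From mathcomp Require Import all_boot all_order all_algebra.
From mathcomp Require Import all_classical all_reals all_analysis.
From mathcomp Require Import zify ring lra.

(**
  If no pair works, every two members A, B have a separating line l_AB each of
  whose closed sides contains at most k < n/18 members, so all but 2k members
  cross l_AB.  Fix one such line l as an axis and order the s >= 16k + 1 members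
  crossing it along l.

  For A < B <= C < D in this order, suppose that D crosses l_AB and A crosses
  l_CD.  Comparing slopes, both crossings take place on the same side of l, say
  above; then B is trapped under D and C under A, so D reaches higher than B,
  and A higher than C.  Let e(X, Y) be the bit "Y reaches higher than X": then
  e(A, C) = 0 and e(B, D) = 1.

  Take A, B, C, D at positions i, i + r, i + t, i + t + r with r = 1, 2.  In the
  bit sequence e(i, i + t), i = 0, 1, ..., the number of 01 patterns at
  distance 1, counted twice, plus the number at distance 2 is at most the length
  plus 2.  Above and below together this accounts for about 2/3 of the weight,
  and the remaining third consists of members missing one of the lines: more
  than the bound 2k allows.
*)

Import Order.TTheory GRing.Theory Num.Theory.
Import numFieldNormedType.Exports.

Set Implicit Arguments.
Unset Strict Implicit.
Unset Printing Implicit Defensive.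

Lemma sum_rises_le (e : nat -> bool) (n : nat) :
  \sum_(i < n) (2 * (~~ e i && e i.+1) + (~~ e i && e i.+2)) <= n + 2.
Proof.
(* A potential: each step changes the sum plus phi by at most 1. *)
pose phi (i : nat) := if e i then ~~ e i.+1 : nat else 2.
suff: \sum_(i < n) (2 * (~~ e i && e i.+1) + (~~ e i && e i.+2)) + phi n
        <= n + phi 0.
  have : phi 0 <= 2 by rewrite /phi; case: ifP => // _; case: (e 1).
  by lia.
elim: n => [|n IHn]; first by rewrite big_ord0.
rewrite big_ord_recr /=; move: IHn; rewrite /phi.
by case: (e n); case: (e n.+1); case: (e n.+2) => /=; lia.
Qed.

Lemma sum_diagonals (F : nat -> nat -> nat) (n : nat) :
  \sum_(t < n) \sum_(i < n - t) F i (i + t) =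
  \sum_(i < n) \sum_(j < n | i <= j) F i j.
Proof.
rewrite (eq_bigr (fun t : 'I_n => \sum_(i < n | i + t < n) F i (i + t)));
  last first.
  move=> t _; rewrite (big_ord_widen n (fun i => F i (i + t))) ?leq_subr //.
  by apply: eq_big => // i; rewrite ltn_subRL addnC.
rewrite (exchange_big_dep xpredT) //=; apply: eq_bigr => i _.
transitivity (\sum_(t < n - i) F i (i + t)).
  rewrite (big_ord_widen n (fun t => F i (i + t))) ?leq_subr //.
  by apply: eq_bigl => t; rewrite ltn_subRL.
move: (nat_of_ord i) (ltnW (ltn_ord i)) => {}i /subnKC <-.
rewrite big_split_ord /= addKn.
rewrite [X in _ = X + _]big1 => [|t]; last by rewrite leqNgt ltn_ord.
rewrite add0n.
by apply: eq_bigl => t; rewrite leq_addr.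
Qed.

Lemma sum_shift_le (P : pred nat) (F : nat -> nat) (r n s : nat) : r + n <= s ->
  \sum_(j < n | P (r + j)) F (r + j) <= \sum_(x < s | P x) F x.
Proof.
move=> /subnKC <-; rewrite !big_split_ord /= -addnA addnCA.
exact: leq_addr.
Qed.

Lemma sum_missed_le (miss : nat -> nat -> nat -> bool) (s m r : nat) :
    0 < r <= 2 ->
    (forall i j, i < j < s ->
       \sum_(x < s | (x < i) || (j < x)) miss i j x <= m) ->
  \sum_(t < s - 2) \sum_(i < s - 2 - t)
     (2 <= t) * (miss i (i + r) (i + t + r) + miss (i + t) (i + t + r) i)
    <= (s - 2) * m.
Proof.
move=> r_bounds miss_le; set n := s - 2.
rewrite (eq_bigr (fun t : 'I_n => \sum_(i < n - t)
    ((i.+2 <= i + t) * miss i (i + r) (i + t + r)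
     + (i.+2 <= i + t) * miss (i + t) (i + t + r) i))); last first.
  move=> t _; apply: eq_bigr => i _; rewrite -mulnDr.
  by congr (nat_of_bool _ * _); lia.
rewrite (sum_diagonals (fun i j => (i.+2 <= j) * miss i (i + r) (j + r)
                                   + (i.+2 <= j) * miss j (j + r) i)).
rewrite (eq_bigr (fun i : 'I_n =>
    \sum_(j < n | i <= j) (i.+2 <= j) * miss i (i + r) (j + r)
    + \sum_(j < n | i <= j) (i.+2 <= j) * miss j (j + r) i)); last first.
  by move=> i _; rewrite big_split.
rewrite big_split /= [X in _ + X](exchange_big_dep xpredT) //= -big_split /=.
rewrite -[n in n * m]card_ord -sum_nat_const; apply: leq_sum => i _.
have i_lt : i < i + r < s by have := ltn_ord i; rewrite /n; lia.
apply: leq_trans (miss_le i (i + r) i_lt).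
rewrite [X in _ <= X](bigID (fun x : 'I_s => i + r < x)) /=; apply: leq_add.
  have n_le : r + n <= s by have := ltn_ord i; rewrite /n; lia.
  rewrite [X in _ <= X](eq_bigl (fun x : 'I_s => i + r < x)); last first.
    by move=> x; case: (i + r < x); rewrite ?orbT ?andbF.
  apply: leq_trans (sum_shift_le (fun x => i + r < x) (miss i (i + r)) n_le).
  rewrite big_mkcond [X in _ <= X]big_mkcond /=; apply: leq_sum => j _.
  rewrite [j + r]addnC [i + r]addnC ltn_add2l.
  case: ifP => // _; case: (leqP i.+2 j) => [/ltnW -> | _].
    by rewrite mul1n.
  by rewrite mul0n.
apply: (@leq_trans (\sum_(x < n | x < i) miss i (i + r) x)).
  rewrite big_mkcond [X in _ <= X]big_mkcond /=; apply: leq_sum => j _.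
  case: ifP => // _; case: (leqP j.+2 i) => [/ltnW -> | _].
    by rewrite mul1n.
  by rewrite mul0n.
have n_le : 0 + n <= s by rewrite /n; lia.
apply: leq_trans (sum_shift_le (fun x => x < i) (miss i (i + r)) n_le) _.
rewrite [X in _ <= X](eq_bigl (fun x : 'I_s => x < i)) // => x.
by have := ltn_ord i; lia.
Qed.

Lemma ordered_family_contradiction (up down : nat -> nat -> bool)
    (miss : nat -> nat -> nat -> bool) (s m : nat) :
    8 * m + 17 <= s ->
    (forall i j, i < j < s ->
       \sum_(x < s | (x < i) || (j < x)) miss i j x <= m) ->
    (forall a b c d, a < b -> b <= c -> c < d -> d < s ->
       [|| miss a b d, miss c d a, ~~ up a c && up b d
         | ~~ down a c && down b d]) ->
  False.
Proof.
move=> s_ge miss_le crossing.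
pose M r i t := miss i (i + r) (i + t + r) + miss (i + t) (i + t + r) i.
have diagonal_ge (t : 'I_(s - 2)) : (2 <= t) * (s - 2 - t)
    <= (2 <= t) * 4 + \sum_(i < s - 2 - t) (2 <= t) * (2 * M 1 i t + M 2 i t).
  case: (leqP 2 t) => t_ge; last by rewrite mul0n.
  rewrite !mul1n; under eq_bigr do rewrite mul1n.
  set n := s - 2 - t.
  have le_up := sum_rises_le (fun i => up i (i + t)) n.
  have le_down := sum_rises_le (fun i => down i (i + t)) n.
  suff: 3 * n <= \sum_(i < n) (2 * M 1 i t + M 2 i t)
     + (\sum_(i < n) (2 * (~~ up i (i + t) && up i.+1 (i.+1 + t))
                      + (~~ up i (i + t) && up i.+2 (i.+2 + t)))
        + \sum_(i < n) (2 * (~~ down i (i + t) && down i.+1 (i.+1 + t))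
                      + (~~ down i (i + t) && down i.+2 (i.+2 + t)))).
    move: le_up le_down => /=; move: (\sum_(i < n) _) => u.
    move: (\sum_(i < n) (2 * (_ && _) + _)) => v.
    by move: (\sum_(i < n) _) => w; lia.
  rewrite -!big_split /= mulnC -[n in n * 3]card_ord -sum_nat_const.
  apply: leq_sum => i _.
  have lt_s : i.+2 + t < s.
    by have := ltn_ord i; have := ltn_ord t; rewrite /n; lia.
  have step r : 0 < r <= 2 ->
      1 <= M r i t + ((~~ up i (i + t) && up (i + r) (i + t + r))
                      + (~~ down i (i + t) && down (i + r) (i + t + r))).
    move=> r12; have /or4P := crossing i (i + r) (i + t) (i + t + r)
      ltac:(lia) ltac:(lia) ltac:(lia) ltac:(lia).
    by rewrite /M => -[] ->; rewrite ?addn1 ?add1n ?addSn ?addnS.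
  have := step 1 isT; have := step 2 isT.
  by rewrite !addn1 !addn2 !addSn; lia.
have total_le := leq_add
  (leq_mul (leqnn 2) (sum_missed_le (isT : 0 < 1 <= 2) miss_le))
  (sum_missed_le (isT : 0 < 2 <= 2) miss_le).
have := leq_sum (index_enum 'I_(s - 2)) (fun t (_ : xpredT t) => diagonal_ge t).
rewrite big_split /=.
have -> : \sum_(t < s - 2) \sum_(i < s - 2 - t)
             (2 <= t) * (2 * M 1 i t + M 2 i t)
   = 2 * (\sum_(t < s - 2) \sum_(i < s - 2 - t) (2 <= t) * M 1 i t)
     + \sum_(t < s - 2) \sum_(i < s - 2 - t) (2 <= t) * M 2 i t.
  rewrite big_distrr -big_split; apply: eq_bigr => t _.
  rewrite big_distrr -big_split; apply: eq_bigr => i _.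
  by rewrite mulnDr mulnCA.
have fours_le : \sum_(t < s - 2) (2 <= t) * 4 <= (s - 2) * 4.
  rewrite -[X in _ <= X * 4]card_ord -sum_nat_const; apply: leq_sum => t _.
  by case: (2 <= t).
have triangle k : 2 * \sum_(t < k) (k - t) = k * k.+1.
  elim: k => [|k IHk]; first by rewrite big_ord0.
  rewrite big_ord_recl /=; under eq_bigr do rewrite /bump /= subSS.
  by rewrite mulnDr IHk; lia.
have -> : \sum_(t < s - 2) (2 <= t) * (s - 2 - t)
          = \sum_(t < s - 4) (s - 4 - t).
  rewrite (_ : s - 2 = (s - 4).+2); last by lia.
  rewrite !big_ord_recl /= !add0n; apply: eq_bigr => t _.
  by rewrite mul1n /bump /= !subSS.
move: total_le (triangle (s - 4)); rewrite /M.
move: fours_le; move: (\sum_(t < s - 2) _ * 4) => f.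
move: (\sum_(t < s - 4) _) => l; move: (2 * _ + _) => w.
nia.
Qed.

Local Open Scope classical_set_scope.
Local Open Scope card_scope.
Local Open Scope ring_scope.

Definition planar_convex (R : realFieldType) (K : R -> R -> Prop) :=
  forall x y x' y' t, K x y -> K x' y' -> 0 <= t <= 1 ->
    K ((1 - t) * x + t * x') ((1 - t) * y + t * y').

Definition planar_disjoint (R : realFieldType) (K K' : R -> R -> Prop) :=
  forall x y, K x y -> K' x y -> False.

Definition overtops (R : realFieldType) (K' K : R -> R -> Prop) :=
  exists x' y', K' x' y' /\ forall x y, K x y -> y < y'.

Definition mirror (R : realFieldType) (K : R -> R -> Prop) :=
  fun x y => K (- x) y.

Definition flip (R : realFieldType) (K : R -> R -> Prop) :=
  fun x y => K x (- y).

Lemma planar_convex_mirror (R : realFieldType) (K : R -> R -> Prop) :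
  planar_convex K -> planar_convex (mirror K).
Proof.
move=> Kc x y x' y' t Kx Kx' t01; rewrite /mirror.
have -> : - ((1 - t) * x + t * x') = (1 - t) * - x + t * - x' by ring.
exact: Kc.
Qed.

Lemma planar_convex_flip (R : realFieldType) (K : R -> R -> Prop) :
  planar_convex K -> planar_convex (flip K).
Proof.
move=> Kc x y x' y' t Kx Kx' t01; rewrite /flip.
have -> : - ((1 - t) * y + t * y') = (1 - t) * - y + t * - y' by ring.
exact: Kc.
Qed.

Lemma overtops_asym (R : realFieldType) (K K' : R -> R -> Prop) :
  overtops K K' -> ~ overtops K' K.
Proof.
move=> [x [y [Kxy K'_lt]]] [x' [y' [K'xy K_lt]]].
by have := lt_trans (K'_lt _ _ K'xy) (K_lt _ _ Kxy); rewrite ltxx.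
Qed.

Lemma transposed_segments_meet (R : realFieldType) (K K' : R -> R -> Prop)
    (x x' z z' h : R) :
  planar_convex K -> planar_convex K' -> planar_disjoint K K' ->
  K x 0 -> K' x' 0 -> x < x' -> K z h -> K' z' h -> z' < z -> False.
Proof.
move=> Kc Kc' dis Kx Kx' xx' Kz Kz' zz'.
pose t := (x' - x) / ((x' - x) + (z - z')).
have t01 : 0 <= t <= 1.
  by rewrite /t divr_ge0 ?ler_pdivrMr ?mul1r; lra.
have := Kc' _ _ _ _ t Kx' Kz' t01.
rewrite (_ : (1 - t) * x' + t * z' = (1 - t) * x + t * z).
  by apply: dis; apply: Kc.
by rewrite /t; field; lra.
Qed.

Lemma right_hit_overtops (R : realFieldType) (K K' : R -> R -> Prop)
    (x x' c s z h : R) :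
  planar_convex K -> planar_convex K' -> planar_disjoint K K' ->
  K x 0 -> K' x' 0 -> x < x' ->
  (forall u v, K u v -> c + s * v <= u) ->
  K' z h -> 0 < h -> z < c + s * h -> overtops K' K.
Proof.
move=> Kc Kc' dis Kx Kx' xx' Kright Kz h0 zlt; exists z, h; split=> // u v Kuv.
rewrite ltNge; apply/negP => hv.
have h_v : 0 <= h / v <= 1 by rewrite divr_ge0 ?ler_pdivrMr; lra.
have := Kc _ _ _ _ (h / v) Kx Kuv h_v.
rewrite mulr0 add0r divfK; last by lra.
move=> Ku; have := Kright _ _ Ku => le_u.
by apply: (transposed_segments_meet Kc Kc' dis Kx Kx' xx' Ku Kz); lra.
Qed.

Lemma left_hit_overtops (R : realFieldType) (K K' : R -> R -> Prop)
    (x x' c s z h : R) :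
  planar_convex K -> planar_convex K' -> planar_disjoint K K' ->
  K x 0 -> K' x' 0 -> x' < x ->
  (forall u v, K u v -> u <= c + s * v) ->
  K' z h -> 0 < h -> c + s * h < z -> overtops K' K.
Proof.
move=> Kc Kc' dis Kx Kx' xx' Kleft Kz h0 zgt.
suff [u [v [Kuv lt_v]]] : overtops (mirror K') (mirror K).
  by exists (- u), v; split=> // w y; rewrite -[w]opprK; exact: lt_v.
apply: (@right_hit_overtops _ _ _ (- x) (- x') (- c) (- s) (- z) h);
  rewrite /mirror ?opprK ?ltrN2 //.
- exact: planar_convex_mirror.
- exact: planar_convex_mirror.
- by move=> u v; exact: dis.
- by move=> u v /Kleft; lra.
- by lra.
Qed.

Lemma hits_same_side (R : realFieldType) (A B C D : R -> R -> Prop)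
    (b c c1 s1 c2 s2 xa ya xd yd : R) :
  (forall u v, A u v -> u <= c1 + s1 * v) ->
  (forall u v, B u v -> c1 + s1 * v <= u) ->
  (forall u v, C u v -> u <= c2 + s2 * v) ->
  (forall u v, D u v -> c2 + s2 * v <= u) ->
  B b 0 -> C c 0 -> b <= c ->
  A xa ya -> c2 + s2 * ya < xa -> D xd yd -> xd < c1 + s1 * yd ->
  0 < ya * yd.
Proof.
move=> Al Br Cl Dr Bb Cc bc Aa hitA Dd hitD.
have := Br _ _ Bb; have := Cl _ _ Cc; have := Al _ _ Aa; have := Dr _ _ Dd.
rewrite !mulr0 !addr0 => le1 le2 le3 le4.
have : 0 < (s1 - s2) * yd by lra.
have : 0 < (s1 - s2) * ya by lra.
move=> pa pd; have := mulr_gt0 pa pd.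
have -> : (s1 - s2) * ya * ((s1 - s2) * yd) = (s1 - s2) ^+ 2 * (ya * yd).
  by ring.
rewrite pmulr_rgt0 // exprn_even_gt0 //=.
by apply: contraTneq pa => ->; rewrite mul0r ltxx.
Qed.

Lemma hits_overtop (R : realFieldType) (A B C D : R -> R -> Prop)
    (a b c d c1 s1 c2 s2 : R) :
  planar_convex A -> planar_convex B -> planar_convex C -> planar_convex D ->
  planar_disjoint B D -> planar_disjoint C A ->
  A a 0 -> B b 0 -> C c 0 -> D d 0 -> a < b -> b <= c -> c < d ->
  (forall u v, A u v -> u <= c1 + s1 * v) ->
  (forall u v, B u v -> c1 + s1 * v <= u) ->
  (forall u v, C u v -> u <= c2 + s2 * v) ->
  (forall u v, D u v -> c2 + s2 * v <= u) ->
  (exists u v, A u v /\ c2 + s2 * v < u) ->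
  (exists u v, D u v /\ u < c1 + s1 * v) ->
  overtops D B /\ overtops A C \/
  overtops (flip D) (flip B) /\ overtops (flip A) (flip C).
Proof.
move=> Ac Bc Cc Dc disBD disCA Aa Bb C0 Dd ab bc cd Al Br Cl Dr.
move=> [xa [ya [Axa hitA]]] [xd [yd [Dxd hitD]]].
have := hits_same_side Al Br Cl Dr Bb C0 bc Axa hitA Dxd hitD.
have bd : b < d by lra.
have ac : a < c by lra.
have [yd0|yd0|->] := ltrgtP yd 0; last by rewrite mulr0 ltxx.
- rewrite nmulr_lgt0 // => ya0; right; split.
  + apply: (@right_hit_overtops _ (flip B) (flip D) b d c1 (- s1) xd (- yd));
      rewrite /flip ?oppr0 ?opprK ?mulrNN ?oppr_gt0 //.
    * exact: planar_convex_flip.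
    * exact: planar_convex_flip.
    * by move=> u v; exact: disBD.
    * by move=> u v /Br; rewrite mulrN mulNr.
  + apply: (@left_hit_overtops _ (flip C) (flip A) c a c2 (- s2) xa (- ya));
      rewrite /flip ?oppr0 ?opprK ?mulrNN ?oppr_gt0 //.
    * exact: planar_convex_flip.
    * exact: planar_convex_flip.
    * by move=> u v; exact: disCA.
    * by move=> u v /Cl; rewrite mulrN mulNr.
- rewrite pmulr_lgt0 // => ya0; left; split.
  + exact: (@right_hit_overtops _ B D b d c1 s1 xd yd).
  + exact: (@left_hit_overtops _ C A c a c2 s2 xa ya).
Qed.

Lemma separating_line_slope (R : realFieldType) (A B : R -> R -> Prop)
    (a b p q r : R) :
  p != 0 \/ q != 0 -> A a 0 -> B b 0 -> a < b ->
  (exists u v, A u v /\ 0 < v) -> (exists u v, A u v /\ v < 0) ->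
  (forall u v, A u v -> p * u + q * v + r <= 0) ->
  (forall u v, B u v -> 0 <= p * u + q * v + r) ->
  0 < p.
Proof.
move=> pq Aa Bb ab [u [v [Auv v0]]] [u' [v' [Auv' v'0]]] Al Br.
have := Al _ _ Aa; have := Br _ _ Bb; have := Al _ _ Auv; have := Al _ _ Auv'.
rewrite !mulr0 !addr0 => le1 le2 le3 le4.
have p0 : 0 <= p by rewrite -(pmulr_lge0 _ (_ : 0 < b - a)); lra.
rewrite lt_neqAle p0 andbT eq_sym; apply/negP => /eqP p_eq0.
case: pq; rewrite ?p_eq0 ?eqxx // => /eqP q0; apply: q0.
move: le1 le2 le3 le4; rewrite p_eq0 !mul0r !add0r => le1 le2 le3 le4.
have r0 : r = 0 by lra.
move: le1 le2; rewrite r0 !addr0 => le1 le2.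
by apply/eqP; rewrite eq_le -(pmulr_lle0 _ v0) le2 /= -(nmulr_lle0 _ v'0).
Qed.

Lemma card_eq_image_ord (T : Type) (n : nat) (K : 'I_n -> set T)
    (X : {set 'I_n}) :
  injective K -> [set K i | i in [set i | i \in X]] #= `I_#|X|.
Proof.
move=> K_inj; rewrite card_eq_sym; apply/card_set_bijP.
have [->|[i0 _]] := set_0Vmem X.
  exists (fun _ => set0); rewrite cards0; split.
  - by move=> j /=.
  - by move=> j j' /[!inE].
  - by move=> Y /= [i /=]; rewrite inE.
exists (fun j => K (nth i0 (enum X) j)); split.
- move=> j /= j_lt; exists (nth i0 (enum X) j) => //=.
  by rewrite -mem_enum mem_nth -?cardE.
- move=> j j'; rewrite !inE /= => j_lt j'_lt /K_inj /eqP.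
  by rewrite nth_uniq ?enum_uniq -?cardE // => /eqP.
- move=> Y /= [i /= iX <-]; exists (index i (enum X)) => /=.
    by rewrite cardE index_mem mem_enum.
  by rewrite nth_index ?mem_enum.
Qed.

Lemma exists_chart (R : realType) (l0 : line R) :
  exists pt : R -> R -> 'rV[R]_2,
    [/\ forall z, exists u v, z = pt u v,
        forall u v, linear_form l0 (pt u v) = offset l0 + v,
        forall t u v u' v',
          pt ((1 - t) * u + t * u') ((1 - t) * v + t * v') =
          (1 - t) *: pt u v + t *: pt u' v' &
        forall l : line R, exists p q r, (p != 0 \/ q != 0) /\
          forall u v, linear_form l (pt u v) - offset l = p * u + q * v + r].
Proof.
set n0 := normal l0 0 0; set n1 := normal l0 0 1; set c := offset l0.
have lift01 : lift ord0 ord0 = 1 :> 'I_2 by exact: val_inj.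
have form_expand (l : line R) z :
    linear_form l z = normal l 0 0 * z 0 0 + normal l 0 1 * z 0 1.
  rewrite /linear_form !big_ord_recl big_ord0 addr0 lift01.
  by [].
have row2 (z z' : 'rV[R]_2) : z 0 0 = z' 0 0 -> z 0 1 = z' 0 1 -> z = z'.
  move=> e0 e1; apply/rowP => j.
  by case: (unliftP 0 j) => [i ->|-> //]; rewrite [i]ord1 lift01.
have normal2_gt0 (l : line R) : 0 < normal l 0 0 ^+ 2 + normal l 0 1 ^+ 2.
  rewrite lt_neqAle addr_ge0 ?sqr_ge0 // andbT eq_sym paddr_eq0 ?sqr_ge0 //.
  rewrite !sqrf_eq0; apply: contraNN (normal_neq0 l) => /andP[/eqP e0 /eqP e1].
  by apply/eqP/row2; rewrite ?e0 ?e1 mxE.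
have := normal2_gt0 l0; rewrite -/n0 -/n1; set N := _ + _ => N_gt0.
have N_neq0 : N != 0 by rewrite gt_eqF.
pose pt u v : 'rV[R]_2 := \row_j
  (if j == 0 then (n0 * (c + v) - n1 * u) / N else (n1 * (c + v) + n0 * u) / N).
have pt0 u v : pt u v 0 0 = (n0 * (c + v) - n1 * u) / N by rewrite mxE.
have pt1 u v : pt u v 0 1 = (n1 * (c + v) + n0 * u) / N by rewrite mxE.
exists pt; split.
- move=> z; exists (n0 * z 0 1 - n1 * z 0 0), (n0 * z 0 0 + n1 * z 0 1 - c).
  by apply: row2; rewrite ?pt0 ?pt1 /N; field.
- by move=> u v; rewrite form_expand pt0 pt1 -/n0 -/n1 /N; field.
- by move=> t u v u' v'; apply: row2; rewrite !mxE /= -/N; field.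
- move=> l; set m0 := normal l 0 0; set m1 := normal l 0 1.
  exists ((m1 * n0 - m0 * n1) / N), ((m0 * n0 + m1 * n1) / N),
    ((m0 * n0 + m1 * n1) * c / N - offset l); split; last first.
    by move=> u v; rewrite form_expand pt0 pt1 -/m0 -/m1; field.
  apply/orP; rewrite -negb_and; apply/negP => /andP[].
  rewrite !mulf_eq0 !invr_eq0 (negbTE N_neq0) !orbF => /eqP e0 /eqP e1.
  have := mulr_gt0 (normal2_gt0 l) N_gt0; rewrite -/m0 -/m1.
  have -> : (m0 ^+ 2 + m1 ^+ 2) * N =
      (m1 * n0 - m0 * n1) ^+ 2 + (m0 * n0 + m1 * n1) ^+ 2.
    by rewrite /N; ring.
  by rewrite e0 e1 expr0n /= addr0 ltxx.
Qed.

Definition below (R : realType) (n : nat) (K : 'I_n -> set 'rV[R]_2)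
    (l : line R) : {set 'I_n} :=
  [set i | `[< K i `<=` lower_half_plane l >]].

Definition above (R : realType) (n : nat) (K : 'I_n -> set 'rV[R]_2)
    (l : line R) : {set 'I_n} :=
  [set i | `[< K i `<=` upper_half_plane l >]].

Definition crossed (R : realType) (n : nat) (K : 'I_n -> set 'rV[R]_2)
    (l : line R) : {set 'I_n} :=
  ~: (below K l :|: above K l).

Lemma crossedP (R : realType) (n : nat) (K : 'I_n -> set 'rV[R]_2)
    (l : line R) (i : 'I_n) : i \in crossed K l ->
  (exists2 z, K i z & linear_form l z < offset l) /\
  (exists2 z, K i z & offset l < linear_form l z).
Proof.
rewrite /crossed !inE negb_or => /andP[/asboolPn not_below /asboolPn not_above].
split; apply: contrapT => none.
- apply: not_above => z Kz; rewrite /upper_half_plane /= leNgt.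
  by apply/negP => lt; apply: none; exists z.
- apply: not_below => z Kz; rewrite /lower_half_plane /= leNgt.
  by apply/negP => lt; apply: none; exists z.
Qed.

Lemma card_crossedC (R : realType) (n k : nat) (K : 'I_n -> set 'rV[R]_2)
    (l : line R) :
  (#|below K l| <= k)%N -> (#|above K l| <= k)%N ->
  (#|~: crossed K l| <= 2 * k)%N.
Proof.
move=> le_below le_above; rewrite /crossed finset.setCK.
by rewrite (leq_trans (leq_card_setU _ _)) // mul2n -addnn leq_add.
Qed.

Lemma convex_conv (R : realType) (A : set 'rV[R]_2) (x y : 'rV[R]_2) (t : R) :
  convex_set A -> A x -> A y -> 0 <= t <= 1 -> A ((1 - t) *: x + t *: y).
Proof.
move=> Ac Ax Ay /andP[t0 t1].
have := Ac y x (Itv01 t0 t1); rewrite !inE => /(_ Ay Ax).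
by rewrite addrC.
Qed.

Lemma separating_line_normal_form (R : realType) (n : nat)
    (K : 'I_n -> set 'rV[R]_2) (pt : R -> R -> 'rV[R]_2) (l : line R)
    (i j : 'I_n) (a b : R) :
  (forall z, exists u v, z = pt u v) ->
  (exists p q r, (p != 0 \/ q != 0) /\
     forall u v, linear_form l (pt u v) - offset l = p * u + q * v + r) ->
  K i (pt a 0) -> K j (pt b 0) -> a < b ->
  (exists u v, K i (pt u v) /\ 0 < v) -> (exists u v, K i (pt u v) /\ v < 0) ->
  separates l (K i) (K j) ->
  exists c s, [/\ forall u v, K i (pt u v) -> u <= c + s * v,
    forall u v, K j (pt u v) -> c + s * v <= u &
    forall x, x \in crossed K l ->
      (exists u v, K x (pt u v) /\ u < c + s * v) /\
      (exists u v, K x (pt u v) /\ c + s * v < u)].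
Proof.
move=> pt_surj [p0 [q0 [r0 [pq0 form0]]]] Ka Kb ab upper_pt lower_pt sep.
have [p [q [r [pq le_i ge_j strict]]]] : exists p q r, [/\ p != 0 \/ q != 0,
    forall u v, K i (pt u v) -> p * u + q * v + r <= 0,
    forall u v, K j (pt u v) -> 0 <= p * u + q * v + r &
    forall x, x \in crossed K l ->
      (exists u v, K x (pt u v) /\ p * u + q * v + r < 0) /\
      (exists u v, K x (pt u v) /\ 0 < p * u + q * v + r)].
  have strict0 x : x \in crossed K l ->
      (exists u v, K x (pt u v) /\ p0 * u + q0 * v + r0 < 0) /\
      (exists u v, K x (pt u v) /\ 0 < p0 * u + q0 * v + r0).
    case/crossedP => [[z Kz ltz] [z' Kz' ltz']]; split.
      have [u [v zE]] := pt_surj z; exists u, v.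
      by rewrite -form0 subr_lt0 -zE.
    have [u [v zE]] := pt_surj z'; exists u, v.
    by rewrite -form0 subr_gt0 -zE.
  case: sep => -[Ki Kj].
    exists p0, q0, r0; split=> // u v.
      by move=> /Ki; rewrite /lower_half_plane /= -form0 subr_le0.
    by move=> /Kj; rewrite /upper_half_plane /= -form0 subr_ge0.
  exists (- p0), (- q0), (- r0); split.
  - by rewrite !oppr_eq0.
  - by move=> u v /Ki; rewrite /upper_half_plane /= -subr_ge0 form0; lra.
  - by move=> u v /Kj; rewrite /lower_half_plane /= -subr_le0 form0; lra.
  - move=> x /strict0[[u [v [Kuv lt0]]] [u' [v' [Kuv' gt0]]]].
    by split; [exists u', v' | exists u, v]; split=> //; lra.
have p_gt0 : 0 < p.
  exact: (@separating_line_slope _ (fun u v => K i (pt u v))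
    (fun u v => K j (pt u v)) a b p q r).
have formE u v : p * u + q * v + r = p * (u - (- r / p + - q / p * v)).
  by field; rewrite gt_eqF.
exists (- r / p), (- q / p); split.
- by move=> u v /le_i; rewrite formE pmulr_rle0 // subr_le0.
- by move=> u v /ge_j; rewrite formE pmulr_rge0 // subr_ge0.
- move=> x /strict[[u [v [Kuv]]]]; rewrite formE pmulr_rlt0 // subr_lt0 => lt0.
  move=> [u' [v' [Kuv']]]; rewrite formE pmulr_rgt0 // subr_gt0 => gt0.
  by split; [exists u, v | exists u', v'].
Qed.

Lemma no_balanced_separation (R : realType) (n k : nat)
    (K : 'I_n -> set 'rV[R]_2) (sep : 'I_n -> 'I_n -> line R) :
  (1 < n)%N -> (18 * k < n)%N ->
  (forall i, convex_set (K i)) ->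
  (forall i j, K i `&` K j !=set0 -> i = j) ->
  (forall i j, i != j -> [/\ separates (sep i j) (K i) (K j),
     (#|below K (sep i j)| <= k)%N & (#|above K (sep i j)| <= k)%N]) ->
  False.
Proof.
move=> n_gt1 k_lt Kc Kdis sepP.
have pair_missed i j : i != j ->
    [set i; j]%SET \subset ~: crossed K (sep i j).
  move=> /sepP[sep_ij _ _]; rewrite /crossed finset.setCK.
  apply/fintype.subsetP => x; rewrite !inE => /orP[]/eqP ->; apply/orP.
  - by case: sep_ij => -[]; [left | right]; exact/asboolP.
  - by case: sep_ij => -[]; [right | left]; exact/asboolP.
pose i0 := Ordinal (ltnW n_gt1); pose i1 := Ordinal n_gt1.
set l0 := sep i0 i1; set S := crossed K l0.
have [pt [pt_surj pt_form pt_affine pt_lines]] := exists_chart l0.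
pose P i : R -> R -> Prop := fun u v => K i (pt u v).
have Pc i : planar_convex (P i).
  move=> u v u' v' t Ku Ku' t01; rewrite /P pt_affine.
  exact: convex_conv.
have Pdis i j : i != j -> planar_disjoint (P i) (P j).
  move=> /eqP neq u v Pi Pj; apply: neq; apply: Kdis; exists (pt u v).
  by split.
have k_gt0 : (0 < k)%N.
  have [//|_ le_below le_above] := sepP i0 i1.
  have := subset_leq_card (pair_missed i0 i1 isT).
  move=> /leq_trans /(_ (card_crossedC le_below le_above)).
  by rewrite cards2; lia.
have S_card : (16 * k < #|S|)%N.
  have [//|_ le_below le_above] := sepP i0 i1.
  have := card_crossedC le_below le_above; rewrite -/l0 -/S.
  by have := cardsC S; rewrite card_ord; lia.
have S_upper i : i \in S -> exists u v, P i u v /\ 0 < v.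
  move=> /crossedP[_ [z Kz]]; have [u [v zE]] := pt_surj z.
  by move: Kz; rewrite zE pt_form ltrDl => Kz v0; exists u, v.
have S_lower i : i \in S -> exists u v, P i u v /\ v < 0.
  move=> /crossedP[[z Kz z_lt] _]; have [u [v zE]] := pt_surj z.
  by move: Kz z_lt; rewrite zE pt_form gtrDl => Kz v0; exists u, v.
have axis_pt i : exists r, i \in S -> P i r 0.
  have [iS|_] := boolP (i \in S); last by exists 0.
  have [u [v [Puv v0]]] := S_upper i iS.
  have [u' [v' [Puv' v'0]]] := S_lower i iS.
  pose t := v / (v - v'); exists ((1 - t) * u + t * u') => _.
  have := Pc i _ _ _ _ t Puv Puv'.
  rewrite (_ : (1 - t) * v + t * v' = 0); last by rewrite /t; field; lra.
  by apply; rewrite /t divr_ge0 ?ler_pdivrMr ?mul1r; lra.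
have [xs xsP] := choice axis_pt.
pose q := sort (relpre xs <=%R) (enum S).
have q_size : size q = #|S| by rewrite size_sort -cardE.
pose X j := nth i0 q j.
have X_S j : (j < #|S|)%N -> X j \in S.
  move=> j_lt; rewrite -mem_enum -(mem_sort (relpre xs <=%R)).
  by rewrite mem_nth ?q_size.
have X_inj j j' : (j < #|S|)%N -> (j' < #|S|)%N -> X j = X j' -> j = j'.
  move=> jl j'l /eqP; rewrite nth_uniq ?q_size ?sort_uniq ?enum_uniq //.
  by move=> /eqP.
have X_neq j j' : (j < j' < #|S|)%N -> X j != X j'.
  by move=> jj'; apply/eqP => /X_inj; lia.
have xs_lt j j' : (j < j' < #|S|)%N -> xs (X j) < xs (X j').
  move=> /[dup] jj' /andP[lt_jj' j'_lt]; rewrite lt_neqAle; apply/andP; split.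
    apply/eqP => xsE; apply: (Pdis (X j) (X j') (X_neq _ _ jj') (xs (X j)) 0).
      exact/xsP/X_S/(ltn_trans lt_jj').
    by rewrite xsE; exact/xsP/X_S.
  have := sort_sorted (T := 'I_n) (leT := relpre xs <=%R)
    (fun i j => le_total (xs i) (xs j)) (enum S).
  move=> /(sorted_ltn_nth (fun y x z => @le_trans _ _ (xs y) (xs x) (xs z)) i0).
  by apply; rewrite ?inE ?q_size // (ltn_trans lt_jj').
pose miss i j x := X x \notin crossed K (sep (X i) (X j)).
apply: (@ordered_family_contradiction
  (fun i j => `[< overtops (P (X j)) (P (X i)) >])
  (fun i j => `[< overtops (flip (P (X j))) (flip (P (X i))) >])
  miss #|S| (2 * k - 2)).
- by lia.
- move=> i j ij.
  have [//|_ le_below le_above] := sepP (X i) (X j); first exact: X_neq.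
  set M := [set x : 'I_#|S| | ((x < i) || (j < x))%N && miss i j x]%SET.
  have -> : (\sum_(x < #|S| | (x < i) || (j < x)) miss i j x)%N = #|M|.
    rewrite -[RHS]sum1_card big_mkcond [RHS]big_mkcond; apply: eq_bigr => x _.
    by rewrite inE; case: ifP => //= _; case: (miss _ _ _).
  have XM : [set X x | x : 'I_#|S| in M]%SET
      \subset ~: crossed K (sep (X i) (X j)) :\: [set X i; X j]%SET.
    apply/fintype.subsetP => y /imsetP[x]; rewrite !inE => /andP[xij xmiss] ->.
    apply/andP; split; last by move: xmiss; rewrite /miss !inE.
    by rewrite negb_or; apply/andP; split; apply/eqP => /X_inj;
      have := ltn_ord x; lia.
  have <- : #|[set X x | x : 'I_#|S| in M]%SET| = #|M|.
    by apply: card_in_imset => x y _ _ /X_inj xy; apply/val_inj/xy.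
  apply: leq_trans (subset_leq_card XM) _.
  rewrite cardsD (finset.setIidPr (pair_missed _ _ (X_neq _ _ ij))).
  rewrite cards2 X_neq //.
  exact: leq_sub2r (card_crossedC le_below le_above).
- move=> a b c d ab bc cd d_lt.
  have [|miss1] := boolP (miss a b d); first by [].
  have [|miss2] := boolP (miss c d a); first by rewrite orbT.
  move: miss1 miss2; rewrite /= /miss !negbK => hitD hitA.
  have SA := X_S a ltac:(lia); have SB := X_S b ltac:(lia).
  have SC := X_S c ltac:(lia); have SD := X_S d ltac:(lia).
  have ltab : xs (X a) < xs (X b) by apply: xs_lt; lia.
  have ltcd : xs (X c) < xs (X d) by apply: xs_lt; lia.
  have lebc : xs (X b) <= xs (X c).
    by move: bc; rewrite leq_eqVlt => /predU1P[-> //|bc]; apply/ltW/xs_lt; lia.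
  have [sep1 _ _] := sepP (X a) (X b) (X_neq a b ltac:(lia)).
  have [sep2 _ _] := sepP (X c) (X d) (X_neq c d ltac:(lia)).
  have [c1 [s1 [Al Br cross1]]] := separating_line_normal_form pt_surj
    (pt_lines _) (xsP _ SA) (xsP _ SB) ltab (S_upper _ SA) (S_lower _ SA) sep1.
  have [c2 [s2 [Cl Dr cross2]]] := separating_line_normal_form pt_surj
    (pt_lines _) (xsP _ SC) (xsP _ SD) ltcd (S_upper _ SC) (S_lower _ SC) sep2.
  have disBD : planar_disjoint (P (X b)) (P (X d)).
    by apply: Pdis; apply: X_neq; lia.
  have disCA : planar_disjoint (P (X c)) (P (X a)).
    by apply: Pdis; rewrite eq_sym; apply: X_neq; lia.
  have [[overD overA]|[overD overA]] :=
    hits_overtop (Pc _) (Pc _) (Pc _) (Pc _) disBD disCA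
    (xsP _ SA) (xsP _ SB) (xsP _ SC) (xsP _ SD) ltab lebc ltcd Al Br Cl Dr
    (cross2 _ hitA).2 (cross1 _ hitD).1.
  + apply/orP; left; apply/andP; split; last exact/asboolP.
    by apply/asboolPn; exact: overtops_asym.
  + apply/orP; right; apply/andP; split; last exact/asboolP.
    by apply/asboolPn; exact: overtops_asym.
Qed.

Theorem theorem2 (R : realType) (n : nat) (C : set (set 'rV[R]_2))
    (n_ge2 : (2 <= n)%N)
    (card_C : C #= `I_n)
    (C_disjoint : trivIset C id)
    (C_compact : forall X, C X -> compact X)
    (C_convex : forall X, C X -> convex_set X) :
  exists A B : set 'rV[R]_2,
    [/\ C A, C B, A <> B &
      forall l : line R, separates l A B ->
        exists F : set (set 'rV[R]_2),
          [/\ F `<=` C,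
              separates_collection l A F \/ separates_collection l B F &
              exists m : nat, F #= `I_m /\ n%:R / 18 <= m%:R :> R]].
Proof.
apply: contrapT => no_pair.
have /card_set_bijP[f [f_fun f_inj f_surj]] : `I_n #= C by rewrite card_eq_sym.
pose K (i : 'I_n) : set 'rV[R]_2 := f i.
have KC i : C (K i) by apply: f_fun => /=.
have K_inj : injective K.
  move=> i j /f_inj; rewrite !inE /=.
  by move=> /(_ (ltn_ord i) (ltn_ord j)) /val_inj.
pose k := (n.-1 %/ 18)%N.
have small_card (m : nat) : ~ (n%:R / 18 <= m%:R :> R) -> (m <= k)%N.
  move=> not_le; rewrite /k leq_divRL // -ltnS prednK; last by lia.
  rewrite ltnNge; apply/negP => le_m; apply: not_le.
  by rewrite ler_pdivrMr // -natrM ler_nat.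
have sep_ex (ij : 'I_n * 'I_n) : exists l : line R, ij.1 != ij.2 ->
    [/\ separates l (K ij.1) (K ij.2),
        (#|below K l| <= k)%N & (#|above K l| <= k)%N].
  case: ij => i j /=; have [<-|/eqP ij] := eqVneq i j.
    have const_neq0 : const_mx 1 != 0 :> 'rV[R]_2.
      by apply/eqP => /matrixP/(_ 0 0)/eqP; rewrite !mxE oner_eq0.
    by exists (Line 0 const_neq0).
  apply: contrapT => no_line; apply: no_pair; exists (K i), (K j).
  split=> // [/K_inj //|l sep_l]; apply: contrapT => no_F.
  apply: no_line; exists l => _; split=> //.
  - apply: small_card => le_m; apply: no_F.
    exists [set K x | x in [set x | x \in below K l]]; split.
    + by move=> _ [x _ <-].
    + case: sep_l => -[Ki Kj]; [right|left]; right; split=> // Y [x /=];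
      by rewrite inE => /asboolP Kx <-.
    + by exists #|below K l|; split=> //; exact: card_eq_image_ord.
  - apply: small_card => le_m; apply: no_F.
    exists [set K x | x in [set x | x \in above K l]]; split.
    + by move=> _ [x _ <-].
    + case: sep_l => -[Ki Kj]; [left|right]; left; split=> // Y [x /=];
      by rewrite inE => /asboolP Kx <-.
    + by exists #|above K l|; split=> //; exact: card_eq_image_ord.
have [sep sepP] := choice sep_ex.
apply: (@no_balanced_separation R n k K (fun i j => sep (i, j))) => //.
- by have := leq_trunc_div n.-1 18; rewrite /k; lia.
- by move=> i; exact: C_convex.
- by move=> i j /C_disjoint => /(_ (KC i) (KC j)) /K_inj.
- by move=> i j ij; exact: (sepP (i, j)).
Qed.
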